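(* Let $R$ be a commutative unital ring and $I$ an ideal of $R$. Then $I$ is a quasi-maximal ideal of $R$ if and only if $I$ is a 2-absorbing ideal such that $\mathrm{V}(I)\subseteq \mathrm{Max}(R)$ and $M/I$ is a principal ideal of $R/I$ for each $M\in \mathrm{V}(I)$.
   Context: A proper ideal $I$ of $R$ (that is, $I\neq R$) is quasi-maximal if for every $a\in R\setminus I$, either $I+Ra=R$ or $I+Ra$ is a maximal ideal of $R$. A nonzero proper ideal $I$ of $R$ is 2-absorbing if for all $a,b,c\in R$ with $abc\in I$, one has $ab\in I$ or $bc\in I$ or $ac\in I$. $\mathrm{V}(I)$ is the set of prime ideals of $R$ containing $I$, and $\mathrm{Max}(R)$ is the set of maximal ideals of $R$.
   Formalization: A 2-absorbing ideal is not required to be nonzero here: with the nonzero condition the equivalence fails for the zero ideal of a field, which is quasi-maximal; for nonzero ideals the statement is unchanged. *)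

(* Defs.v *)
From HB Require Import structures.
From mathcomp Require Import all_boot all_order all_algebra.
From mathcomp Require Import boolp classical_sets.

Set Implicit Arguments.
Unset Strict Implicit.
Unset Printing Implicit Defensive.

Import GRing.Theory.

Local Open Scope classical_set_scope.
Local Open Scope ring_scope.
Local Open Scope quotient_scope.

(* The ideals of ring_quotient.v are proper, boolean-valued and live in
   nontrivial rings. Here an ideal may be the whole ring, and the ring may be
   the zero ring. *)
Definition is_ideal (R : comPzRingType) (I : set R) : Prop :=
  [/\ I 0, forall x y, I x -> I y -> I (x + y) & forall r x, I x -> I (r * x)].

Record ideal (R : comPzRingType) := Ideal {
  ideal_set :> set R;
  ideal_setP : is_ideal ideal_set }.

Section IdealPredicates.
Variable R : comPzRingType.
Implicit Types (I J P M : set R) (a : R).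

Definition proper_ideal I : Prop := is_ideal I /\ I <> setT.

Definition prime_ideal P : Prop :=
  proper_ideal P /\ forall x y, P (x * y) -> P x \/ P y.

Definition maximal_ideal M : Prop :=
  proper_ideal M /\ forall J, is_ideal J -> M `<=` J -> J = M \/ J = setT.

Definition V I : set (set R) := [set P | prime_ideal P /\ I `<=` P].

Definition Max : set (set R) := [set M | maximal_ideal M].

Definition multiples a : set R := [set r * a | r in setT].

Definition principal_ideal J : Prop := exists a, J = multiples a.

Definition ideal_add I J : set R := [set x + y | x in I & y in J].

Definition quasi_maximal I : Prop :=
  proper_ideal I /\
  forall a, ~ I a ->
    ideal_add I (multiples a) = setT \/
    maximal_ideal (ideal_add I (multiples a)).

(* Some authors only call nonzero ideals 2-absorbing. The zero ideal is allowed
   here: it is quasi-maximal when R is a field, so a characterization of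
   quasi-maximal ideals by 2-absorbing ones has to include it. *)
Definition two_absorbing I : Prop :=
  proper_ideal I /\
  forall a b c, I (a * b * c) -> I (a * b) \/ I (b * c) \/ I (a * c).

End IdealPredicates.

Arguments Max : clear implicits.

(* The quotient ring R/I, on the carrier of the additive quotient of
   ring_quotient.v, whose ring structure there requires I to be proper. *)
Section IdealQuotient.
Variables (R : comPzRingType) (I : ideal R).

Definition ideal_pred : {pred R} := fun x => x \in (I : set R).

Lemma ideal_predE x : (x \in ideal_pred) = (x \in (I : set R)).
Proof. by []. Qed.

Lemma ideal_predM r x : x \in ideal_pred -> r * x \in ideal_pred.
Proof.
by rewrite !ideal_predE !in_setE; have [_ _ IM] := ideal_setP I; apply: IM.
Qed.

Lemma ideal_zmod_closed : zmod_closed ideal_pred.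
Proof.
have [I0 ID IM] := ideal_setP I.
split=> [|x y]; rewrite ?ideal_predE ?in_setE // => Ix Iy.
by apply: ID => //; rewrite -mulN1r; apply: IM.
Qed.

HB.instance Definition _ := GRing.isZmodClosed.Build R ideal_pred
  ideal_zmod_closed.

Definition quot_ring : Type := {ideal_quot ideal_pred}.

HB.instance Definition _ := GRing.Zmodule.on quot_ring.
HB.instance Definition _ := EqQuotient.on quot_ring.

Definition quot_pi (x : R) : quot_ring := \pi_quot_ring x.
Definition quot_one : quot_ring := quot_pi 1.
Definition quot_mul (x y : quot_ring) : quot_ring :=
  quot_pi (repr x * repr y).

Lemma quot_piK (x : quot_ring) : quot_pi (repr x) = x.
Proof. exact: reprK. Qed.

Lemma quot_eqP (x y : R) : reflect (quot_pi x = quot_pi y) (x - y \in ideal_pred).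
Proof. by rewrite Quotient.idealrBE; apply: eqP. Qed.

Lemma quot_piB : zmod_morphism quot_pi.
Proof. exact: (raddfB (\pi_{ideal_quot ideal_pred})). Qed.

HB.instance Definition _ :=
  GRing.isZmodMorphism.Build R quot_ring quot_pi quot_piB.

Lemma quot_piM (x y : R) : quot_pi (x * y) = quot_mul (quot_pi x) (quot_pi y).
Proof.
apply/quot_eqP; set x' := repr _; set y' := repr _.
have -> : x * y - x' * y' = y * (x - x') + x' * (y - y').
  by rewrite !mulrBr (mulrC y x) (mulrC y x') addrA subrK.
by apply: rpredD; apply: ideal_predM; apply/quot_eqP; rewrite quot_piK.
Qed.

Lemma quot_mulA : associative quot_mul.
Proof.
move=> x y z; rewrite -(quot_piK x) -(quot_piK y) -(quot_piK z).
rewrite -(quot_piM (repr y) (repr z)) -(quot_piM (repr x) (repr y)).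
by rewrite -!quot_piM mulrA.
Qed.

Lemma quot_mulC : commutative quot_mul.
Proof. by move=> x y; rewrite /quot_mul mulrC. Qed.

Lemma quot_mul1 : left_id quot_one quot_mul.
Proof. by move=> x; rewrite -(quot_piK x) -quot_piM mul1r. Qed.

Lemma quot_mulDl : left_distributive quot_mul +%R.
Proof.
move=> x y z; rewrite -(quot_piK x) -(quot_piK y) -(quot_piK z).
by rewrite -raddfD -!quot_piM mulrDl raddfD.
Qed.

HB.instance Definition _ := GRing.Zmodule_isComPzRing.Build quot_ring
  quot_mulA quot_mulC quot_mul1 quot_mulDl.

Lemma quot_pi_monoid_morphism : monoid_morphism quot_pi.
Proof. by split=> // x y; apply: quot_piM. Qed.

HB.instance Definition _ :=
  GRing.isMonoidMorphism.Build R quot_ring quot_pi quot_pi_monoid_morphism.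

Definition quot_ideal (M : set R) : set quot_ring :=
  [set quot_pi x | x in M].

End IdealQuotient.

Arguments quot_pi {R} I x.
Arguments quot_ideal {R} I M.

(* Main.v *)
Require Import Defs.
From mathcomp Require Import all_boot all_order all_algebra.
From mathcomp Require Import boolp classical_sets.
From mathcomp Require Import ring.

(** Write R' for R/I.

    If I is quasi-maximal and P is a prime containing some a outside I, then
    I + Ra is proper, hence maximal, hence equal to P; this yields at once that
    P is maximal and that P/I is principal. The only other prime to consider is
    P = I, and there comparing I + Ra with I + Ra^2 excludes a maximal
    I + Ra (lemma [quasi_maximal_prime_maximal]). For 2-absorption, let
    abc be in I: if I + Rb = R then ac lies in I, and otherwise I + Rb = I + Rbc
    by maximality unless bc is in I, so ab lies in I + Rabc, which is I.

    Conversely, all primes of R' are maximal, so R' is strongly pi-regular: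
    some x^n (1 - xy) vanishes for each x. The 2-absorbing property lowers the
    exponent and leaves a dichotomy (lemma [square_or_regular]): each x of R'
    has x^2 = 0 or x = x^2 y. Let a be nonzero in R' and not a unit. It lies in
    a prime M, which is maximal and generated by one element m, and M = R'a has
    to be shown. If m^2 = 0, then a = rm with r outside M, and r is invertible
    modulo m, so m is a multiple of a. If m = m^2 y, then M is generated by the
    idempotent e = my; here p = a + (1 - e) is outside M, which makes p, and
    with it a = ep, von Neumann regular, a (1 - az) = 0. The product
    p e (1 - az) is then zero, and 2-absorption leaves only e (1 - az) = 0. *)

Set Implicit Arguments.
Unset Strict Implicit.
Unset Printing Implicit Defensive.

Import GRing.Theory.

Local Open Scope classical_set_scope.
Local Open Scope ring_scope.

(** * Ideals of a commutative ring *)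

(* ring_quotient.v uses the same name for a structure over nontrivial rings. *)
Local Notation proper_ideal := Defs.proper_ideal.

Section Ideals.
Variable R : comPzRingType.
Implicit Types (I J M P S : set R) (a b c x y : R).

Lemma ideal_lin I r s x y : is_ideal I -> I x -> I y -> I (r * x + s * y).
Proof. by case=> _ ID IM Ix Iy; apply: ID; apply: IM. Qed.

Lemma ideal_mull I r x : is_ideal I -> I x -> I (r * x).
Proof. by case=> _ _; apply. Qed.

Lemma ideal_eqT I : is_ideal I -> I 1 -> I = setT.
Proof.
move=> idI I1; apply/seteqP; split=> // x _.
by rewrite -(mulr1 x); apply: ideal_mull.
Qed.

Lemma proper_ideal1 I : proper_ideal I -> ~ I 1.
Proof. by case=> idI nIT I1; apply: nIT; apply: ideal_eqT. Qed.

Local Notation adjoin I a := (ideal_add I (multiples a)).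

Lemma adjoinE I a x : adjoin I a x <-> exists i r, I i /\ x = i + r * a.
Proof.
split=> [[i Ii [_ [r _ <-] <-]]|[i [r [Ii ->]]]]; first by exists i, r.
by exists i => //; exists (r * a) => //; exists r.
Qed.

Lemma adjoin_is_ideal I a : is_ideal I -> is_ideal (adjoin I a).
Proof.
move=> idI; have [I0 ID IM] := idI; split.
- by apply/adjoinE; exists 0, 0; split=> //; ring.
- move=> x y /adjoinE[i [r [Ii ->]]] /adjoinE[j [s [Ij ->]]].
  by apply/adjoinE; exists (i + j), (r + s); split; [apply: ID | ring].
- move=> t x /adjoinE[i [r [Ii ->]]].
  by apply/adjoinE; exists (t * i), (t * r); split; [apply: IM | ring].
Qed.

Lemma sub_adjoin I a : I `<=` adjoin I a.
Proof. by move=> x Ix; apply/adjoinE; exists x, 0; split=> //; ring. Qed.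

Lemma mem_adjoin I a : is_ideal I -> adjoin I a a.
Proof. by case=> I0 _ _; apply/adjoinE; exists 0, 1; split=> //; ring. Qed.

Lemma adjoin_sub I J a : is_ideal J -> I `<=` J -> J a -> adjoin I a `<=` J.
Proof.
move=> idJ IJ Ja x /adjoinE[i [r [Ii ->]]].
by rewrite -[i]mul1r; apply: ideal_lin => //; apply: IJ.
Qed.

Lemma maximal_adjoin1 M a : maximal_ideal M -> ~ M a ->
  exists r, M (1 - a * r).
Proof.
move=> [[idM _] maxM] Ma.
case: (maxM _ (adjoin_is_ideal a idM) (@sub_adjoin M a)) => [eqM|eqT].
  by case: Ma; rewrite -eqM; apply: mem_adjoin.
have /adjoinE[i [r [Mi def1]]] : adjoin M a 1 by rewrite eqT.
by exists r; have -> : 1 - a * r = i by rewrite def1; ring.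
Qed.

(** Krull: an ideal maximal among those that avoid the multiplicative set S is
    prime, because s * t stays in S for s in S of the form p + r x and t in S
    of the form q + u y. *)
Lemma prime_avoiding J S : is_ideal J -> S 1 ->
    (forall x y, S x -> S y -> S (x * y)) -> (forall x, J x -> ~ S x) ->
  exists P, [/\ prime_ideal P, J `<=` P & forall x, P x -> ~ S x].
Proof.
move=> idJ S1 SM JS.
pose good K := is_ideal K /\ forall x, K x -> ~ S x.
(* Zorn is applied to the sets A with J `|` A good, so that the union of the
   empty chain qualifies. *)
have [|A [[idP PS] maxA]] := @Zorn_bigcup R [set A | good (J `|` A)].
  move=> F Fgood totF; set U := \bigcup_(X in F) X.
  have cover x y : (J `|` U) x -> (J `|` U) y ->
      exists K, [/\ good K, K `<=` J `|` U, K x & K y].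
    have step X z w : F X -> (J `|` X) z -> (J `|` X) w ->
        exists K, [/\ good K, K `<=` J `|` U, K z & K w].
      move=> FX Xz Xw; exists (J `|` X); split=> //; first exact: (Fgood X FX).
      by move=> t [Jt|Xt]; [left | right; exists X].
    move=> [Jx|[X FX Xx]] [Jy|[Y FY Yy]].
    - by exists J; split=> // t Jt; left.
    - by apply: (step Y) => //; [left | right].
    - by apply: (step X) => //; [right | left].
    - have [XY|YX] := totF X Y FX FY.
        by apply: (step Y) => //; right=> //; apply: XY.
      by apply: (step X) => //; right=> //; apply: YX.
  split; last first.
    by move=> x Ux; have [K [[_ KS] _ Kx _]] := cover x x Ux Ux; apply: KS.
  split; first by left; case: idJ.
    move=> x y Ux Uy; have [K [[[_ KD _] _] KU Kx Ky]] := cover x y Ux Uy.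
    by apply: KU; apply: KD.
  move=> r x Ux; have [K [[[_ _ KM] _] KU Kx _]] := cover x x Ux Ux.
  by apply: KU; apply: KM.
set P := J `|` A in idP PS.
have meetS x : ~ P x -> exists2 s, S s & adjoin P x s.
  move=> Px; apply: contrapT => avoid; apply: (maxA (adjoin P x)).
    split=> [t At|sub]; first by apply: sub_adjoin; right.
    by apply: Px; right; apply/sub/mem_adjoin.
  rewrite /= setUidr; last by move=> t Jt; apply: sub_adjoin; left.
  split; first exact: adjoin_is_ideal.
  by move=> s xs Ss; apply: avoid; exists s.
exists P; split=> //; last by move=> t Jt; left.
split; first by split=> // PT; apply: (PS 1); rewrite ?PT.
move=> x y Pxy; apply: contrapT => /not_orP[Px Py].
have [s Ss /adjoinE[p [r [Pp defs]]]] := meetS x Px.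
have [t St /adjoinE[q [u [Pq deft]]]] := meetS y Py.
apply: (PS (s * t)); last exact: SM.
have -> : s * t = 1 * (t * p + (r * x) * q) + (r * u) * (x * y).
  by rewrite defs deft; ring.
by apply: ideal_lin => //; apply: ideal_lin.
Qed.

(** * Quasi-maximal ideals *)

Lemma quasi_maximal_proper_adjoin I J a : quasi_maximal I -> proper_ideal J ->
  I `<=` J -> J a -> ~ I a -> maximal_ideal (adjoin I a).
Proof.
move=> [[idI _] qmI] pJ IJ Ja nIa; case: (qmI a nIa) => // eqT.
case: (proper_ideal1 pJ); apply: (@adjoin_sub I J a pJ.1 IJ Ja).
by rewrite eqT.
Qed.

Lemma quasi_maximal_adjoin_eq I J a : quasi_maximal I -> proper_ideal J ->
  I `<=` J -> J a -> ~ I a -> J = adjoin I a.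
Proof.
move=> qmI pJ IJ Ja nIa.
have [_ maxIa] := quasi_maximal_proper_adjoin qmI pJ IJ Ja nIa.
by case: (maxIa J pJ.1 (adjoin_sub pJ.1 IJ Ja)) => // /pJ.2.
Qed.

(** If a proper ideal J above I contains some a outside I, then J = I + Ra^2,
    so a (1 - ra) is in I for some r. As I is prime, 1 - ra is in I, and J
    contains both a and 1 - ra. *)
Lemma quasi_maximal_prime_maximal I :
  quasi_maximal I -> prime_ideal I -> maximal_ideal I.
Proof.
move=> qmI [pI primeI]; split=> // J idJ IJ.
have [JT|nJT] := pselect (J = setT); [by right | left].
have pJ : proper_ideal J by [].
apply/seteqP; split=> // a Ja; apply: contrapT => nIa.
have nIaa : ~ I (a * a) by move=> /primeI[].
have Jaa : J (a * a) by apply: ideal_mull.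
have := Ja; rewrite {1}(quasi_maximal_adjoin_eq qmI pJ IJ Jaa nIaa).
move=> /adjoinE[i [r [Ii defa]]].
have : I (a * (1 - r * a)).
  by have -> : a * (1 - r * a) = i by rewrite mulrBr {1}defa; ring.
case/primeI=> // /IJ J1; apply: (proper_ideal1 pJ).
have -> : 1 = 1 * (1 - r * a) + r * a :> R by ring.
exact: ideal_lin.
Qed.

Lemma quasi_maximal_two_absorbing I : quasi_maximal I -> two_absorbing I.
Proof.
move=> qmI; have [pI qm] := qmI; have idI := pI.1; split=> // a b c Iabc.
have [Ibc|nIbc] := pselect (I (b * c)); first by right; left.
have [bT|nbT] := pselect (adjoin I b = setT).
  right; right; have /adjoinE[i [r [Ii def1]]] : adjoin I b 1 by rewrite bT.
  have -> : a * c = (a * c) * i + r * (a * b * c).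
    by rewrite -[LHS]mulr1 def1; ring.
  exact: ideal_lin.
have pb : proper_ideal (adjoin I b) by split=> //; apply: adjoin_is_ideal.
left; have bcb : adjoin I b (b * c).
  by rewrite mulrC; apply: (ideal_mull _ pb.1); apply: mem_adjoin.
have := mem_adjoin b idI.
rewrite {1}(quasi_maximal_adjoin_eq qmI pb (@sub_adjoin I b) bcb nIbc).
move=> /adjoinE[i [r [Ii defb]]].
have -> : a * b = a * i + r * (a * b * c) by rewrite {1}defb; ring.
exact: ideal_lin.
Qed.

(** * 2-absorbing ideals of dimension zero *)

(** The elements x^n (1 - xy) form a multiplicative set. No maximal ideal M
    avoids it: M contains x or some 1 - xy. So the set meets I, and 2-absorption
    applied to x, x and x^n (1 - xy) brings the exponent down. *)
Lemma square_or_regular I x : two_absorbing I -> V I `<=` Max R ->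
  I (x * x) \/ exists y, I (x * (1 - x * y)).
Proof.
move=> [[idI _] absI] VI.
have [n [y Iny]] : exists n y, I (x ^+ n * (1 - x * y)).
  apply: contrapT => avoid.
  pose S := [set s | exists n y, s = x ^+ n * (1 - x * y)].
  have [||||P [primeP IP PS]] := @prime_avoiding I S.
  - exact: idI.
  - by exists 0, 0; rewrite expr0; ring.
  - move=> _ _ [n [y ->]] [k [z ->]].
    by exists (n + k)%N, (y + z - x * y * z); rewrite exprD; ring.
  - by move=> s Is [n [y def_s]]; apply: avoid; exists n, y; rewrite -def_s.
  have maxP : maximal_ideal P by apply: VI.
  have nPx : ~ P x.
    by move=> /PS; apply; exists 1, 0; rewrite expr1; ring.
  have [r Pr] := maximal_adjoin1 maxP nPx.
  by apply: (PS _ Pr); exists 0, r; rewrite expr0 mul1r.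
have [Ixx|nIxx] := pselect (I (x * x)); [by left | right; exists y].
elim: n Iny => [|n IHn] Iny.
  by apply: ideal_mull; rewrite // -[X in I X]mul1r.
case: n => [|n] in IHn Iny *; first by rewrite expr1 in Iny.
apply: IHn; rewrite exprS -mulrA.
case: (absI x x (x ^+ n * (1 - x * y))) => [||[]//] //.
by move: Iny; rewrite !exprS !mulrA.
Qed.

(** With a in M, this says that I + Ra = M. The proof separates the two cases of
    [square_or_regular] for m: in the first M is nilpotent modulo I, in the
    second it is generated by an idempotent. *)
Lemma adjoin_prime_generator I M m a : two_absorbing I -> V I `<=` Max R ->
  V I M -> M = adjoin I m -> M a -> ~ I a -> adjoin I a m.
Proof.
move=> absI VI VM defM Ma nIa; have [[idI _] abs3] := absI.
have maxM : maximal_ideal M by apply: VI.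
have [[[idM nMT] primeM] IM] := VM.
have M1 : ~ M 1 by apply: proper_ideal1.
have Mm : M m by rewrite defM; apply: mem_adjoin.
have [Imm|[y Imy]] := square_or_regular m absI VI.
  (* m^2 is in I: a = rm with r invertible modulo M, since a is not in I *)
  have := Ma; rewrite {1}defM => /adjoinE[i [r [Ii defa]]].
  have nMr : ~ M r.
    rewrite {1}defM => /adjoinE[j [s [Ij defr]]]; apply: nIa.
    have -> : a = 1 * (1 * i + m * j) + s * (m * m) by rewrite defa defr; ring.
    by apply: ideal_lin => //; apply: ideal_lin.
  have [t] := maximal_adjoin1 maxM nMr.
  rewrite {1}defM => /adjoinE[j [s [Ij def1]]].
  apply/adjoinE; exists (1 * (m * j + (- t) * i) + s * (m * m)), t; split.
    by apply: ideal_lin => //; apply: ideal_lin.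
  have -> : m = m * (1 - r * t) + m * r * t by ring.
  by rewrite {1}def1 defa; ring.
(* e is an idempotent generator of M modulo I; adding 1 - e to a gives an
   element outside M without changing its product with e. *)
pose e := m * y; pose p := a + 1 - e.
have Me : M e by rewrite /e mulrC; apply: ideal_mull.
have nMp : ~ M p.
  move=> Mp; apply: M1.
  have -> : 1 = 1 * (1 * p + 1 * e) + (-1) * a by rewrite /p; ring.
  by apply: ideal_lin => //; apply: ideal_lin.
have Iae : I (a * (1 - e)).
  have := Ma; rewrite {1}defM => /adjoinE[i [r [Ii ->]]].
  have -> : (i + r * m) * (1 - e) = (1 - e) * i + r * (m * (1 - m * y)).
    by rewrite /e; ring.
  exact: ideal_lin.
have [/IM /primeM[]//|[z Ipz]] := square_or_regular p absI VI.
have Iee : I (e * (1 - e)).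
  have -> : e * (1 - e) = y * (m * (1 - m * y)) by rewrite /e; ring.
  exact: ideal_mull.
(* Modulo I, ep = a, so multiplying the relation for p by e gives one for a. *)
have Iaz : I (a * (1 - a * z)).
  have -> : a * (1 - a * z) =
      1 * (e * (p * (1 - p * z)) + (z + 1 - p * z) * (a * (1 - e)))
      + (p * z - 1) * (e * (1 - e)) by rewrite /p; ring.
  by apply: ideal_lin => //; apply: ideal_lin.
have Ipez : I (p * e * (1 - a * z)).
  have -> : p * e * (1 - a * z) =
      1 * (1 * (a * (1 - a * z)) + (1 - a * z) * (e * (1 - e)))
      + (a * z - 1) * (a * (1 - e)) by rewrite /p; ring.
  by apply: ideal_lin => //; apply: ideal_lin.
have [Ipe|[Iez|/IM Mpz]] := abs3 _ _ _ Ipez.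
- case: nIa.
  have -> : a = 1 * (1 * (p * e) + 1 * (a * (1 - e))) + (-1) * (e * (1 - e)).
    by rewrite /p; ring.
  by apply: ideal_lin => //; apply: ideal_lin.
- apply/adjoinE.
  exists (m * (e * (1 - a * z)) + (1 - a * z) * (m * (1 - m * y))), (m * z).
  by split; [apply: ideal_lin | rewrite /e; ring].
- have [//|Mz] := primeM _ _ Mpz; case: M1.
  have -> : 1 = 1 * (1 - a * z) + z * a by ring.
  exact: ideal_lin.
Qed.

End Ideals.

(** * The characterization of quasi-maximal ideals *)

Local Notation adjoin I a := (ideal_add I (multiples a)).

(** Lets the argument stay in R, computing modulo I by membership in I. *)
Lemma principal_quotP (R : comPzRingType) (I : ideal R) (M : set R) :
    is_ideal M -> I `<=` M ->
  principal_ideal (quot_ideal I M) <-> exists m, M = adjoin I m.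
Proof.
move=> idM IM.
have pi_eq x y : (I : set R) (x - y) -> quot_pi I x = quot_pi I y.
  by move=> Ixy; apply/quot_eqP; rewrite ideal_predE in_setE.
have eq_pi x y : quot_pi I x = quot_pi I y -> (I : set R) (x - y).
  by move/quot_eqP; rewrite ideal_predE in_setE.
split=> [[q defMI]|[m defM]]; [exists (repr q) | exists (quot_pi I m)];
  apply/seteqP; split.
- move=> x Mx; have : quot_ideal I M (quot_pi I x) by exists x.
  rewrite defMI => -[s _]; rewrite -{1}(quot_piK s) -{1}(quot_piK q) -rmorphM.
  move=> /esym/eq_pi Ix; apply/adjoinE.
  by exists (x - repr s * repr q), (repr s); split=> //; ring.
- move=> x /adjoinE[i [r [Ii defx]]].
  have : multiples q (quot_pi I x).
    exists (quot_pi I r) => //; rewrite -{1}(quot_piK q) -rmorphM.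
    by apply/esym/pi_eq; rewrite defx addrK.
  rewrite -defMI => -[t Mt /esym/eq_pi/IM Mxt].
  have -> : x = 1 * (x - t) + 1 * t by ring.
  exact: ideal_lin.
- move=> _ [x + <-]; rewrite {1}defM => /adjoinE[i [r [Ii defx]]].
  exists (quot_pi I r) => //; rewrite -rmorphM.
  by apply/esym/pi_eq; rewrite defx addrK.
- move=> _ [s _ <-]; rewrite -{1}(quot_piK s) -rmorphM.
  exists (repr s * m) => //; apply: ideal_mull => //; rewrite defM.
  exact: mem_adjoin (ideal_setP I).
Qed.

Theorem theorem5p2 (R : comPzRingType) (I : ideal R) :
  quasi_maximal I <->
  [/\ two_absorbing I,
      V I `<=` Max R
    & forall M : set R, V I M -> principal_ideal (quot_ideal I M)].
Proof.
have idI := ideal_setP I; split=> [qmI|[absI VI prinI]].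
  split; first exact: quasi_maximal_two_absorbing.
    move=> P [primeP IP].
    have [PI|/existsNP[a /not_implyP[Pa nIa]]] := pselect (P `<=` I).
      have eqIP : P = I by apply/seteqP.
      by rewrite eqIP in primeP *; apply: quasi_maximal_prime_maximal.
    rewrite /= {1}(quasi_maximal_adjoin_eq qmI primeP.1 IP Pa nIa).
    exact: quasi_maximal_proper_adjoin qmI primeP.1 IP Pa nIa.
  move=> P [[pP _] IP]; apply/(principal_quotP pP.1 IP).
  have [PI|/existsNP[a /not_implyP[Pa nIa]]] := pselect (P `<=` I).
    have [I0 _ _] := idI; exists 0; apply/seteqP; split.
      by move=> x /PI; apply: sub_adjoin.
    by apply: adjoin_sub => //; [exact: pP.1 | apply: IP].
  by exists a; apply: quasi_maximal_adjoin_eq.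
split=> [|a nIa]; first exact: absI.1.
have idIa := adjoin_is_ideal a idI.
have [|nIaT] := pselect (adjoin I a = setT); [by left | right].
have [|||M [primeM IaM _]] := @prime_avoiding _ _ [set 1] idIa.
- by [].
- by move=> _ _ -> ->; rewrite /= mulr1.
- by move=> x Iax x1; apply: nIaT; apply: ideal_eqT; rewrite -?x1.
have IM : I `<=` M by move=> x /sub_adjoin/IaM; apply.
have VM : V I M by [].
have idM : is_ideal M := primeM.1.1.
have [m defM] := (principal_quotP idM IM).1 (prinI M VM).
have Ma : M a by apply/IaM/mem_adjoin.
suff -> : adjoin I a = M by apply: VI.
apply/seteqP; split=> //; rewrite {1}defM; apply: adjoin_sub => //.
  exact: sub_adjoin.
exact: adjoin_prime_generator absI VI VM defM Ma nIa.
Qed.
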